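(* For a semigroup $X$ the following conditions are equivalent: (1) $\varphi(X)$ is a commutative Clifford semigroup; (2) $\varphi(X)$ is an inverse semigroup; (3) the idempotents of the semigroup $\varphi(X)$ commute, and $\varphi(X)$ is sub-Clifford or $\varphi(X)$ is regular in $N_2(X)$; (4) $X$ is isomorphic to one of the semigroups $C_2$, $L_n$, or $L_n\sqcup C_2$ for some $n\in\omega$.
   Context: An upfamily on a set $X$ is a family $\mathcal F$ of nonempty subsets of $X$ such that $F\in\mathcal F$ and $F\subset E\subset X$ imply $E\in\mathcal F$. $\upsilon(X)$ is the set of all upfamilies on $X$. An upfamily $\mathcal F$ is linked if $A\cap B\neq\emptyset$ for all $A,B\in\mathcal F$, and a filter if $A\cap B\in\mathcal F$ for all $A,B\in\mathcal F$. $N_2(X)$ and $\varphi(X)$ denote the sets of linked upfamilies and of filters on $X$. Each $x\in X$ is identified with $\langle x\rangle=\{A\subset X: x\in A\}$. For a family $\mathcal C$ of nonempty subsets, $\langle\mathcal C\rangle=\{A\subset X:\exists C\in\mathcal C,\ C\subset A\}$. For a semigroup $(X,* )$ the operation is extended to $\upsilon(X)$ by $\mathcal A*\mathcal B=\big\langle \bigcup_{a\in A} a*B_a : A\in\mathcal A,\ \{B_a\}_{a\in A}\subset\mathcal B\big\rangle$; $N_2(X)$ and $\varphi(X)$ are subsemigroups of $\upsilon(X)$. A semigroup $S$ is inverse if each $x$ has a unique $x^{-1}$ with $xx^{-1}x=x$, $x^{-1}xx^{-1}=x^{-1}$; Clifford if it is a union of groups; sub-Clifford if it is a union of cancellative subsemigroups.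 A subsemigroup $X\subset Y$ is regular in $Y$ if each $x\in X$ satisfies $x\in xYx$. $C_n=\{z\in\mathbb C: z^n=1\}$; $L_n=\{0,\dots,n-1\}$ with the operation $\min$ ($L_0=\emptyset$). For semigroups $(X,* )$, $(Y,\star)$, the disjoint ordered union $X\sqcup Y$ is the disjoint union with operation $x\circ y=x*y$ for $x,y\in X$; $x\circ y=x$ if $x\in X,y\in Y$; $x\circ y=y$ if $x\in Y,y\in X$; $x\circ y=x\star y$ for $x,y\in Y$. *)

(* Defs.v *)
From HB Require Import structures.
From mathcomp Require Import all_boot all_order all_algebra all_field.
Set Implicit Arguments. Unset Strict Implicit. Unset Printing Implicit Defensive.
Import GRing.Theory Num.Theory.
Local Open Scope ring_scope.

Definition family (X : Type) := (X -> Prop) -> Prop.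

Definition is_upfamily (X : Type) (F : family X) : Prop :=
  (forall A, F A -> exists x, A x) /\
  (forall A B : X -> Prop, F A -> (forall x, A x -> B x) -> F B).

Definition is_linked (X : Type) (F : family X) : Prop :=
  is_upfamily F /\ (forall A B, F A -> F B -> exists x, A x /\ B x).

Definition is_filter (X : Type) (F : family X) : Prop :=
  is_upfamily F /\ (forall A B, F A -> F B -> F (fun x => A x /\ B x)).

(** Extension of the operation:
   A * B = < U_{a in A} a * B_a : A in A, {B_a}_{a in A} subset B > *)
Definition ext_op (X : Type) (op : X -> X -> X) (FA FB : family X) : family X :=
  fun E => exists A, FA A /\
    exists Bf : X -> X -> Prop,
      (forall a, A a -> FB (Bf a)) /\
      (forall a b, A a -> Bf a b -> E (op a b)).

(** Semigroup-theoretic notions for a subset S of a magma (T, op)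
    (S is intended to be a subsemigroup). *)
Section SubsetNotions.
Variables (T : Type) (op : T -> T -> T).

Definition sg_commutative (S : T -> Prop) : Prop :=
  forall x y, S x -> S y -> op x y = op y x.

Definition is_subgroup (S G : T -> Prop) : Prop :=
  (forall g, G g -> S g) /\
  (forall g h, G g -> G h -> G (op g h)) /\
  exists e, G e /\ (forall g, G g -> op e g = g /\ op g e = g) /\
    (forall g, G g -> exists h, G h /\ op g h = e /\ op h g = e).

Definition sg_clifford (S : T -> Prop) : Prop :=
  forall x, S x -> exists G, is_subgroup S G /\ G x.

Definition sg_inverse (S : T -> Prop) : Prop :=
  forall x, S x -> exists y, (S y /\ op (op x y) x = x /\ op (op y x) y = y) /\
    forall z, S z -> op (op x z) x = x -> op (op z x) z = z -> z = y.

Definition idempotents_commute (S : T -> Prop) : Prop :=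
  forall e f, S e -> S f -> op e e = e -> op f f = f -> op e f = op f e.

Definition is_cancellative_subsemigroup (S C : T -> Prop) : Prop :=
  (forall c, C c -> S c) /\
  (forall a b, C a -> C b -> C (op a b)) /\
  (forall a b c, C a -> C b -> C c ->
     (op a c = op b c -> a = b) /\ (op c a = op c b -> a = b)).

Definition sg_sub_clifford (S : T -> Prop) : Prop :=
  forall x, S x -> exists C, is_cancellative_subsemigroup S C /\ C x.

Definition regular_in (S Y : T -> Prop) : Prop :=
  forall x, S x -> exists y, Y y /\ x = op (op x y) x.

End SubsetNotions.

Definition sg_iso (X Y : Type) (opX : X -> X -> X) (opY : Y -> Y -> Y) : Prop :=
  exists f : X -> Y, bijective f /\ forall x y, f (opX x y) = opY (f x) (f y).

(** C_n = {z in C : z^n = 1} under multiplication (C modelled by algC). *)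
Definition Cn (n : nat) := {z : algC | z ^+ n == 1}.

Lemma Cn_closed (n : nat) (a b : algC) :
  a ^+ n == 1 -> b ^+ n == 1 -> (a * b) ^+ n == 1.
Proof. by move=> /eqP ha /eqP hb; rewrite exprMn ha hb mulr1. Qed.

Definition Cn_op (n : nat) (a b : Cn n) : Cn n :=
  exist _ (sval a * sval b) (Cn_closed (svalP a) (svalP b)).

Definition Ln_op (n : nat) (i j : 'I_n) : 'I_n := if (i <= j)%N then i else j.

Definition ord_union_op (X Y : Type) (opX : X -> X -> X) (opY : Y -> Y -> Y)
  (u v : X + Y) : X + Y :=
  match u, v with
  | inl x, inl y => inl (opX x y)
  | inl x, inr _ => inl x
  | inr _, inl y => inl y
  | inr x, inr y => inr (opY x y)
  end.

(* Main.v *)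
(** On a finite [X] every nonempty filter is generated by a single set, and in the
   semigroups of (4) a product of three elements is one of its factors; hence
   [F F F = F] for every filter [F], and [{F, F F}] is a group.

   Conversely, assume (3) and feed well-chosen filters into it.  In the regular
   case the commuting idempotent sets generated by [x y, x] and by [x y, y], with
   [y] an inverse of [x], give [x y = y x]; in the sub-Clifford case a tail filter
   of the powers of [x] makes [x] periodic.  Either way [x x x = x].  Then small
   sets [A] (with [A A A = A A], resp. [A = A w A] locally) show that the idempotents
   form a chain, that subgroups have at most two elements, and that only the top
   idempotent may carry a nontrivial one.  The chain is finite because the tail
   filters along the odd and the even terms of a strictly monotone sequence are
   non-commuting idempotents. *)
Require Import Defs.
From mathcomp Require Import all_boot all_order all_algebra all_field.
From mathcomp.classical Require Import boolp.
From mathcomp Require Import zify.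
Set Implicit Arguments. Unset Strict Implicit. Unset Printing Implicit Defensive.

(** * Inverse semigroups, unions of groups and commuting idempotents *)

Section AbstractSemigroup.
Variables (T : Type) (mul : T -> T -> T) (S : T -> Prop).
Hypothesis mulS : forall x y, S x -> S y -> S (mul x y).
Hypothesis mulA : forall x y z, S x -> S y -> S z ->
  mul x (mul y z) = mul (mul x y) z.

Local Notation "x ** y" := (mul x y) (at level 40, left associativity).

(** The inverse taken inside a subgroup works. For a second inverse [z], commuting [y x] past [z x]
    gives [y x = z x], and this forces [y = z]. *)
Lemma inverse_of_commutative_clifford :
  sg_commutative mul S -> sg_clifford mul S -> sg_inverse mul S.
Proof.
move=> mulC cliff x Sx.
have [G [[GS [_ [e [Ge [eG invG]]]]] Gx]] := cliff x Sx.
have [y [Gy [xy yx]]] := invG x Gx.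
have Sy := GS y Gy.
have xyx : x ** y ** x = x by rewrite xy; case: (eG x Gx).
have yxy : y ** x ** y = y by rewrite yx; case: (eG y Gy).
exists y; split=> // z Sz xzx zxz.
have yx_zx : y ** x = z ** x.
  rewrite -{1}xzx -(mulA Sx Sz Sx) (mulA Sy Sx (mulS Sz Sx)).
  rewrite (mulC _ _ (mulS Sy Sx) (mulS Sz Sx)).
  by rewrite -(mulA Sz Sx (mulS Sy Sx)) (mulA Sx Sy Sx) xyx.
rewrite -yxy yx_zx -(mulA Sz Sx Sy) (mulC _ _ Sx Sy) yx_zx (mulC _ _ Sz Sx).
by rewrite (mulA Sz Sx Sz).
Qed.

(** If [x] is the inverse of [e f], then so is [f x e]; hence [x = f x e], which makes [x]
    idempotent and therefore its own inverse, so [e f = x]. Once all such products are idempotent,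
    [e f] and [f e] are both inverses of [e f]. *)
Lemma idempotents_commute_of_inverse :
  sg_inverse mul S -> idempotents_commute mul S.
Proof.
move=> invS.
have inv_uniq x y z : S x -> S y -> S z ->
    x ** y ** x = x -> y ** x ** y = y ->
    x ** z ** x = x -> z ** x ** z = z -> y = z.
  move=> Sx Sy Sz xyx yxy xzx zxz; have [w [_ w_uniq]] := invS x Sx.
  by rewrite (w_uniq y) // (w_uniq z).
have prod_idem e f : S e -> S f -> e ** e = e -> f ** f = f ->
    e ** f ** (e ** f) = e ** f.
  move=> Se Sf ee ff.
  have Sef := mulS Se Sf.
  have [x [[Sx [efxef xefx]] _]] := invS _ Sef.
  have Sfxe := mulS (mulS Sf Sx) Se.
  have xE : f ** x ** e = x.
    apply: (@inv_uniq (e ** f)) => //.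
    - rewrite -[RHS]efxef !mulA //; try by do ?apply: mulS.
      rewrite -(mulA Se Sf Sf) ff -(mulA (mulS Sef Sx) Se Se) ee //.
    - rewrite -[in RHS]xefx !mulA //; try by do ?apply: mulS.
      rewrite -(mulA (mulS Sf Sx) Se Se) ee.
      by rewrite -(mulA (mulS (mulS Sf Sx) Se) Sf Sf) ff.
  have xx : x ** x = x.
    rewrite -{3}xE -[in RHS]xefx -{1 2}xE.
    rewrite !mulA //; by do ?apply: mulS.
  suff -> : e ** f = x by [].
  by apply: (@inv_uniq x) => //; rewrite !xx.
move=> e f Se Sf ee ff.
have Sef := mulS Se Sf; have Sfe := mulS Sf Se.
have sandwich g h : S g -> S h -> g ** g = g -> h ** h = h ->
    g ** h ** (h ** g) ** (g ** h) = g ** h.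
  move=> Sg Sh gg hh; rewrite -[RHS]prod_idem //.
  have Sgh := mulS Sg Sh.
  rewrite !mulA //; try by do ?apply: mulS.
  rewrite -(mulA Sg Sh Sh) hh -(mulA (mulS Sgh Sg) Sg Sh).
  by rewrite -(mulA Sgh Sg (mulS Sg Sh)) (mulA Sg Sg Sh) gg mulA.
apply: (@inv_uniq (e ** f)) => //; try exact: sandwich.
- by rewrite !prod_idem.
- by rewrite !prod_idem.
Qed.

Lemma clifford_of_cubes :
  (forall x, S x -> x ** x ** x = x) -> sg_clifford mul S.
Proof.
move=> cube x Sx.
have Sxx := mulS Sx Sx.
have xxx : x ** (x ** x) = x by rewrite mulA ?cube.
have xxxx : x ** x ** (x ** x) = x ** x by rewrite mulA // cube.
exists (fun y => y = x \/ y = x ** x); split; last by left.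
split; first by move=> g [->|->].
split; first by move=> g h [->|->] [->|->]; rewrite ?cube ?xxx ?xxxx; auto.
exists (x ** x); split; first by right.
split; first by move=> g [->|->]; rewrite ?cube ?xxx ?xxxx.
move=> g [->|->]; first by exists x; split; [left|].
by exists (x ** x); split; [right|].
Qed.

End AbstractSemigroup.

Local Notation family := Defs.family.

(** * Products of upfamilies, principal filters and tail filters *)

Section Upfamilies.
Variables (X : Type) (op : X -> X -> X).
Hypothesis opA : associative op.

Local Notation "x ** y" := (op x y) (at level 40, left associativity).
Local Notation "F <*> G" := (ext_op op F G) (at level 40, left associativity).

Lemma family_eqP (F G : family X) : (forall E, F E <-> G E) -> F = G.
Proof. by move=> FG; apply/funext => E; apply/propext. Qed.

Lemma filter_up (F : family X) (A B : X -> Prop) :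
  is_filter F -> F A -> (forall x, A x -> B x) -> F B.
Proof. by move=> [[_ up] _]; apply: up. Qed.

(** The largest admissible choice of [B_a] is the set of [b] with [a b] in [E]; this gives the
    nested-quantifier form known from products of ultrafilters. *)
Lemma ext_opE (F G : family X) : is_upfamily F -> is_upfamily G ->
  F <*> G = fun E => F (fun a => G (fun b => E (a ** b))).
Proof.
move=> [_ upF] [_ upG]; apply: family_eqP => E; split.
  move=> [A [FA [B [GB AB]]]]; apply: upF FA _ => a Aa.
  by apply: upG (GB a Aa) _ => b; apply: AB.
move=> FE; exists (fun a => G (fun b => E (a ** b))); split=> //.
by exists (fun a b => E (a ** b)).
Qed.

Lemma ext_op_upfamily (F G : family X) :
  is_upfamily F -> is_upfamily G -> is_upfamily (F <*> G).
Proof.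
move=> uF uG; have FGE := ext_opE uF uG.
case: uF uG => [neF upF] [neG upG].
split=> [E | A B]; rewrite FGE.
  by move=> /neF [a /neG [b Eab]]; exists (a ** b).
by move=> FA AB; apply: upF FA _ => a Ga; apply: upG Ga _ => b; apply: AB.
Qed.

Lemma ext_op_filter (F G : family X) :
  is_filter F -> is_filter G -> is_filter (F <*> G).
Proof.
move=> [uF IF] [uG IG]; split; first exact: ext_op_upfamily.
rewrite ext_opE // => A B FA FB.
by apply: (uF.2) (IF _ _ FA FB) _ => a [Ga Gb]; apply: IG.
Qed.

Lemma ext_opA (F G H : family X) :
  is_upfamily F -> is_upfamily G -> is_upfamily H ->
  F <*> (G <*> H) = F <*> G <*> H.
Proof.
move=> uF uG uH.
rewrite (ext_opE uF (ext_op_upfamily uG uH)) (ext_opE (ext_op_upfamily uF uG) uH).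
rewrite !ext_opE //; apply: family_eqP => E.
by split=> FE; apply: (uF.2) FE _ => a Ga; apply: (uG.2) Ga _ => b Hb;
  apply: (uH.2) Hb _ => c; rewrite opA.
Qed.

Lemma filter_opA (F G H : family X) :
  is_filter F -> is_filter G -> is_filter H -> F <*> (G <*> H) = F <*> G <*> H.
Proof. by move=> [uF _] [uG _] [uH _]; apply: ext_opA. Qed.

Lemma filter_linked (F : family X) : is_filter F -> is_linked F.
Proof.
move=> [uF IF]; split=> // A B FA FB.
exact: uF.1 _ (IF _ _ FA FB).
Qed.

(** The filter generated by one set; [principal (eq x)] is the filter identified with the point
    [x]. *)
Definition principal (A : X -> Prop) : family X := fun E => forall x, A x -> E x.

Lemma principal_filter (A : X -> Prop) a : A a -> is_filter (principal A).
Proof.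
move=> Aa; split; first split.
- by move=> E AE; exists a; apply: AE.
- by move=> E E' AE EE' x /AE; apply: EE'.
- by move=> E E' AE AE' x Ax; split; [apply: AE | apply: AE'].
Qed.

Lemma principal_opE (A B : X -> Prop) a b E : A a -> B b ->
  (principal A <*> principal B) E <-> forall x y, A x -> B y -> E (x ** y).
Proof.
move=> Aa Bb.
rewrite ext_opE; [|exact: (principal_filter Aa).1|exact: (principal_filter Bb).1].
by split=> AB x; [move=> y Ax; apply: AB | move=> Ax y; apply: AB].
Qed.

Lemma principal_op3E (A B C : X -> Prop) a b c E : A a -> B b -> C c ->
  (principal A <*> principal B <*> principal C) E <->
  forall x y z, A x -> B y -> C z -> E (x ** y ** z).
Proof.
move=> Aa Bb Cc.
have fA := principal_filter Aa; have fB := principal_filter Bb.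
have fC := principal_filter Cc.
rewrite ext_opE; [|exact: (ext_op_filter fA fB).1|exact: fC.1].
rewrite (principal_opE _ Aa Bb).
by split=> AB x y => [z Ax By | Ax By z]; apply: AB.
Qed.

(** The image under [u] of the filter of cofinite subsets of [J]; a filter as soon as [J] is
    unbounded. *)
Definition tail (u : nat -> X) (J : nat -> Prop) : family X :=
  fun E => exists N, forall n, N < n -> J n -> E (u n).

Lemma tail_filter u (J : nat -> Prop) :
  (forall N, exists n, N < n /\ J n) -> is_filter (tail u J).
Proof.
move=> infJ; split; first split.
- by move=> E [N EN]; have [n [Nn Jn]] := infJ N; exists (u n); apply: EN.
- by move=> E E' [N EN] EE'; exists N => n Nn Jn; apply/EE'/EN.
- move=> E E' [N EN] [N' EN']; exists (maxn N N') => n.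
  by rewrite gtn_max => /andP[Nn N'n] Jn; split; [apply: EN|apply: EN'].
Qed.

Lemma tail_opE u u' (J J' : nat -> Prop) E :
  (forall N, exists n, N < n /\ J n) -> (forall N, exists n, N < n /\ J' n) ->
  (tail u J <*> tail u' J') E <->
  exists N, forall m, N < m -> J m ->
    exists M, forall n, M < n -> J' n -> E (u m ** u' n).
Proof.
move=> iJ iJ'.
by rewrite ext_opE; [|exact: (tail_filter u iJ).1|exact: (tail_filter u' iJ').1].
Qed.

End Upfamilies.

(** * Filters on finite semigroups *)

(** Each point outside the intersection of all members is omitted by some member; intersecting
    finitely many of these, by induction along an enumeration, shows that the intersection is itself
    a member. *)
Lemma filter_core (X : Type) (T : finType) (u : T -> X) (F : family X) :
  (forall x, exists t, u t = x) -> is_filter F -> forall A, F A ->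
  F (fun x => forall E, F E -> E x).
Proof.
move=> u_surj fF A FA.
suff FS (s : seq T) : F (fun x => forall t, t \in s -> u t = x ->
    forall E, F E -> E x).
  apply: (filter_up fF (FS (enum T))) => x cx E FE.
  by have [t tx] := u_surj x; apply: (cx t) => //; rewrite mem_enum.
elim: s => [|t s IHs]; first exact: (filter_up fF FA).
have [core_t | /existsNP[E /not_implyP[FE nEt]]] :=
    EM (forall E, F E -> E (u t)).
  apply: (filter_up fF IHs) => x cx t'; rewrite inE => /predU1P[-> <- //|].
  exact: cx.
apply: (filter_up fF (fF.2 _ _ IHs FE)) => x [cx Ex] t'.
by rewrite inE => /predU1P[-> tx | /cx //]; rewrite tx in nEt.
Qed.

(* The condition on triple products makes every subset satisfy [A A A = A]. *)
Lemma filter_commutative_clifford (X : Type) (op : X -> X -> X)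
    (T : finType) (u : T -> X) :
  associative op -> commutative op ->
  (forall x, exists t, u t = x) ->
  (forall x, op (op x x) x = x) ->
  (forall x y z, let p := op (op x y) z in p = x \/ p = y \/ p = z) ->
  sg_commutative (ext_op op) (@is_filter X) /\
  sg_clifford (ext_op op) (@is_filter X).
Proof.
move=> opA opC u_surj cube triple.
have swap (F G : family X) E : is_filter F -> is_filter G ->
    ext_op op F G E -> ext_op op G F E.
  move=> fF fG; rewrite !ext_opE; [|exact: fG.1|exact: fF.1|exact: fF.1|exact: fG.1].
  move=> FE; have [x Gx] := fF.1.1 _ FE.
  have Fc := filter_core u_surj fF FE; have Gc := filter_core u_surj fG Gx.
  apply: (filter_up fG Gc) => b cb; apply: (filter_up fF FE) => a Ga.
  by rewrite opC; apply: cb Ga.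
split.
  by move=> F G fF fG; apply: family_eqP => E; split; apply: swap.
apply: clifford_of_cubes; first exact: ext_op_filter.
  by move=> F G H; apply: filter_opA.
move=> F fF; have fFF := ext_op_filter op fF fF.
apply: family_eqP => E.
rewrite (ext_opE op fFF.1 fF.1) (ext_opE op fF.1 fF.1); split.
  move=> FE; have Fc := filter_core u_surj fF FE.
  apply: (filter_up fF Fc) => x cx.
  by have := cx _ (cx _ (cx _ FE)); rewrite cube.
move=> FE; have Fc := filter_core u_surj fF FE.
apply: (filter_up fF Fc) => x cx; apply: (filter_up fF Fc) => y cy.
apply: (filter_up fF Fc) => z cz.
have := triple x y z; move=> /= [|[]] ->; [exact: cx|exact: cy|exact: cz].
Qed.

Lemma commutative_clifford_of_iso (X Y : Type) (opX : X -> X -> X) (opY : Y -> Y -> Y)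
    (T : finType) (u : T -> Y) :
  sg_iso opX opY -> commutative opY ->
  (forall y, exists t, u t = y) ->
  (forall y, opY (opY y y) y = y) ->
  (forall x y z, let p := opY (opY x y) z in p = x \/ p = y \/ p = z) ->
  associative opX ->
  sg_commutative (ext_op opX) (@is_filter X) /\
  sg_clifford (ext_op opX) (@is_filter X).
Proof.
move=> [f [[g fK gK] fM]] YC u_surj cube triple opA.
have f_inj := can_inj fK.
apply: (@filter_commutative_clifford _ _ T (g \o u)) => //.
- by move=> x y; apply: f_inj; rewrite !fM YC.
- by move=> x; have [t tx] := u_surj (f x); exists t; rewrite /= tx fK.
- by move=> x; apply: f_inj; rewrite !fM cube.
- move=> x y z /=; have := triple (f x) (f y) (f z).
  by rewrite /= -!fM => -[|[]] /f_inj; auto.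
Qed.

(** * The models [C_2], [L_n] and their ordered unions *)

Lemma C2_one_closed : ((1 : algC) ^+ 2 == 1)%R.
Proof. by rewrite GRing.expr1n. Qed.

Lemma C2_minus_one_closed : ((- 1 : algC) ^+ 2 == 1)%R.
Proof. by rewrite GRing.sqrrN GRing.expr1n. Qed.

Definition C2_one : Cn 2 := exist (fun z : algC => z ^+ 2 == 1)%R _ C2_one_closed.
Definition C2_minus_one : Cn 2 := exist (fun z : algC => z ^+ 2 == 1)%R _ C2_minus_one_closed.
(** Turns the product of [C_2] into exclusive or, so that its identities reduce to case analysis. *)
Definition C2_of_bool (b : bool) : Cn 2 := if b then C2_minus_one else C2_one.

Lemma C2_of_bool_surj z : exists b, C2_of_bool b = z.
Proof.
case: z => z z2; have := z2; rewrite GRing.sqrf_eq1 => /orP[] /eqP zE.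
  by exists false; apply: val_inj.
by exists true; apply: val_inj.
Qed.

Lemma C2_of_bool_inj : injective C2_of_bool.
Proof.
have neq1 : (1 != - 1 :> algC)%R.
  by rewrite -GRing.subr_eq0 GRing.opprK (Num.Theory.pnatr_eq0 algC 2).
by case=> -[] // /(congr1 val) /= /eqP; rewrite ?(negPf neq1) // eq_sym (negPf neq1).
Qed.

Lemma C2_of_boolM a b :
  Cn_op (C2_of_bool a) (C2_of_bool b) = C2_of_bool (a (+) b).
Proof.
by apply: val_inj; case: a; case: b;
  rewrite /= ?GRing.mulrNN ?GRing.mulr1 ?GRing.mul1r.
Qed.

Lemma Ln_opC n : commutative (@Ln_op n).
Proof.
by move=> i j; apply: val_inj; rewrite /Ln_op; case: ifP; case: ifP => /=; lia.
Qed.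

Lemma Ln_op_idem n (i : 'I_n) : Ln_op i i = i.
Proof. by rewrite /Ln_op leqnn. Qed.

Lemma Ln_op_select n (i j : 'I_n) : Ln_op i j = i \/ Ln_op i j = j.
Proof. by rewrite /Ln_op; case: ifP; auto. Qed.

Lemma Ln_commutative_clifford (X : Type) (op : X -> X -> X) n :
  associative op -> sg_iso op (@Ln_op n) ->
  sg_commutative (ext_op op) (@is_filter X) /\
  sg_clifford (ext_op op) (@is_filter X).
Proof.
move=> opA iso; apply: (@commutative_clifford_of_iso _ _ _ _ 'I_n id iso) => //.
- exact: Ln_opC.
- by move=> y; exists y.
- by move=> y; rewrite !Ln_op_idem.
- move=> x y z /=; case: (Ln_op_select (Ln_op x y) z) => ->; last by auto.
  by case: (Ln_op_select x y) => ->; auto.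
Qed.

Lemma ord_union_C2_commutative_clifford (X : Type) (op : X -> X -> X) n :
  associative op -> sg_iso op (ord_union_op (@Ln_op n) (@Cn_op 2)) ->
  sg_commutative (ext_op op) (@is_filter X) /\
  sg_clifford (ext_op op) (@is_filter X).
Proof.
move=> opA iso.
pose u (t : 'I_n + bool) : 'I_n + Cn 2 :=
  match t with inl i => inl i | inr b => inr (C2_of_bool b) end.
have u_surj y : exists t, u t = y.
  case: y => [i|z]; first by exists (inl i).
  by have [b <-] := C2_of_bool_surj z; exists (inr b).
apply: (@commutative_clifford_of_iso _ _ _ _ _ u iso) => //.
- move=> x y; case: (u_surj x) => {x}[[i|a]] <-; case: (u_surj y) => {y}[[j|b]] <- //=.
    by rewrite Ln_opC.
  by rewrite !C2_of_boolM addbC.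
- move=> x; case: (u_surj x) => {x}[[i|a]] <- /=; first by rewrite !Ln_op_idem.
  by rewrite !C2_of_boolM addbb.
- move=> x y z /=.
  case: (u_surj x) => {x}[[i|a]] <-; case: (u_surj y) => {y}[[j|b]] <-;
    case: (u_surj z) => {z}[[k|c]] <- /=; auto.
  + case: (Ln_op_select (Ln_op i j) k) => ->; last by auto.
    by case: (Ln_op_select i j) => ->; auto.
  + by case: (Ln_op_select i j) => ->; auto.
  + by case: (Ln_op_select i k) => ->; auto.
  + by case: (Ln_op_select j k) => ->; auto.
  + by rewrite !C2_of_boolM; case: a; case: b; case: c; rewrite /=; auto.
Qed.

Lemma C2_commutative_clifford (X : Type) (op : X -> X -> X) :
  associative op -> sg_iso op (@Cn_op 2) ->
  sg_commutative (ext_op op) (@is_filter X) /\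
  sg_clifford (ext_op op) (@is_filter X).
Proof.
move=> opA iso; apply: (@commutative_clifford_of_iso _ _ _ _ _ C2_of_bool iso) => //.
- move=> x y; case: (C2_of_bool_surj x) => {x}a <-.
  by case: (C2_of_bool_surj y) => {y}b <-; rewrite !C2_of_boolM addbC.
- exact: C2_of_bool_surj.
- move=> x; case: (C2_of_bool_surj x) => {x}a <-.
  by rewrite !C2_of_boolM addbb.
- move=> x y z /=; case: (C2_of_bool_surj x) => {x}a <-.
  case: (C2_of_bool_surj y) => {y}b <-; case: (C2_of_bool_surj z) => {z}c <-.
  by rewrite !C2_of_boolM; case: a; case: b; case: c; rewrite /=; auto.
Qed.

(** * Elementwise consequences of condition (3) *)

Section Structure.
Variables (X : Type) (op : X -> X -> X).
Hypothesis opA : associative op.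
Hypothesis filter_idemC : idempotents_commute (ext_op op) (@is_filter X).
Hypothesis filter_alt : sg_sub_clifford (ext_op op) (@is_filter X) \/
  regular_in (ext_op op) (@is_filter X) (@is_linked X).

Local Notation "x ** y" := (op x y) (at level 40, left associativity).
Local Notation "F <*> G" := (ext_op op F G) (at level 40, left associativity).

(** A set with [A A = A] generates an idempotent filter; that two of these commute means
    [A B = B A], stated here for a single product. *)
Lemma set_idem_comm (A B : X -> Prop) a b :
  (forall x y, A x -> A y -> A (x ** y)) ->
  (forall x, A x -> exists y z, [/\ A y, A z & x = y ** z]) ->
  (forall x y, B x -> B y -> B (x ** y)) ->
  (forall x, B x -> exists y z, [/\ B y, B z & x = y ** z]) ->
  A a -> B b -> exists a' b', [/\ A a', B b' & a ** b = b' ** a'].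
Proof.
move=> AA A2 BB B2 Aa Bb.
have idem C c : (forall x y, C x -> C y -> C (x ** y)) ->
    (forall x, C x -> exists y z, [/\ C y, C z & x = y ** z]) -> C c ->
    principal C <*> principal C = principal C.
  move=> CC C2 Cc; apply: family_eqP => E; rewrite (principal_opE _ _ Cc Cc).
  split=> [CE x /C2[y [z [Cy Cz ->]]] | CE x y Cx Cy]; first exact: CE.
  exact/CE/CC.
have comm := filter_idemC (principal_filter Aa) (principal_filter Bb)
  (idem A a AA A2 Aa) (idem B b BB B2 Bb).
have : (principal B <*> principal A)
    (fun z => exists a' b', [/\ A a', B b' & z = b' ** a']).
  by rewrite (principal_opE _ _ Bb Aa) => y x By Ax; exists x, y.
by rewrite -comm (principal_opE _ _ Aa Bb); apply.
Qed.

Lemma idem_comm e f : e ** e = e -> f ** f = f -> e ** f = f ** e.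
Proof.
move=> ee ff.
have [||||a [b [<- <- //]]] := @set_idem_comm (eq e) (eq f) e f _ _ _ _ erefl erefl.
- by move=> x y <- <-.
- by move=> x <-; exists e, e.
- by move=> x y <- <-.
- by move=> x <-; exists f, f.
Qed.

Inductive span2 (a b : X) : X -> Prop :=
| span2_l : span2 a b a
| span2_r : span2 a b b
| span2_op x y : span2 a b x -> span2 a b y -> span2 a b (x ** y).

(* The subsemigroups generated by [xy, x] and by [xy, y] are idempotent as sets,
   hence commute; comparing the products gives [yx <= xy]. *)
Lemma inverse_pair_le x y : x ** y ** x = x -> y ** x ** y = y ->
  x ** y ** (y ** x) = y ** x.
Proof.
move=> xyx yxy; set e := x ** y.
have ee : e ** e = e by rewrite /e opA xyx.
(* [e] is a left unit on the span of [e, x] and a right unit on the span of [e, y]; this is why both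
   spans are idempotent as sets. *)
have eA z : span2 e x z -> e ** z = z.
  by elim=> // u v _ eu _ _; rewrite opA eu.
have Ce z : span2 e y z -> z ** e = z.
  by elim=> [||u v _ _ _ ve] //; [rewrite /e opA | rewrite -opA ve].
have [||||a [b [_ Ab yxE]]] :=
    @set_idem_comm (span2 e y) (span2 e x) y x _ _ _ _ (span2_r _ _) (span2_r _ _).
- exact: span2_op.
- by move=> z Cz; exists z, e; split; [|exact: span2_l|rewrite Ce].
- exact: span2_op.
- by move=> z Az; exists e, z; split; [exact: span2_l| |rewrite eA].
by rewrite yxE opA (eA b).
Qed.

Lemma inverse_pair_comm x y :
  x ** y ** x = x -> y ** x ** y = y -> x ** y = y ** x.
Proof.
move=> xyx yxy.
rewrite -(inverse_pair_le xyx yxy) -{1}(inverse_pair_le yxy xyx).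
by apply: idem_comm; rewrite opA ?xyx ?yxy.
Qed.

(** Regularity puts the sets of all [w] with [a w A] inside [A], resp. [b w A] inside [A], into one
    linked family, so they share a point. *)
Lemma regular_set (A : X -> Prop) a b :
  regular_in (ext_op op) (@is_filter X) (@is_linked X) -> A a -> A b ->
  exists w, forall c, A c -> A (a ** w ** c) /\ A (b ** w ** c).
Proof.
move=> reg Aa Ab.
have [Y [[uY linkY] AYA]] := reg _ (principal_filter Aa).
have uA := (principal_filter Aa).1.
have : principal A A by [].
rewrite {1}AYA (ext_opE op (ext_op_upfamily _ uA uY) uA) (ext_opE op uA uY).
move=> /[dup] /(_ _ Aa) Ya /(_ _ Ab) Yb.
have [w [wa wb]] := linkY _ _ Ya Yb.
by exists w => c Ac; split; [exact: wa | exact: wb].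
Qed.

Lemma cube_of_regular x :
  regular_in (ext_op op) (@is_filter X) (@is_linked X) -> x ** x ** x = x.
Proof.
move=> reg.
(* The singleton gives [x w x = x], and [w x w] is then an inverse of [x]. *)
have [w /(_ x erefl)[xwx _]] := @regular_set (eq x) x x reg erefl erefl.
pose y := w ** x ** w.
have xwxK z : x ** (w ** (x ** z)) = x ** z by rewrite !opA -xwx.
have xyx : x ** y ** x = x by rewrite /y -!opA xwxK opA -xwx.
have yxy : y ** x ** y = y.
  by rewrite /y -!opA !xwxK.
have xyC := inverse_pair_comm xyx yxy.
pose e := x ** y.
have ee : e ** e = e by rewrite /e opA xyx.
have ex : e ** x = x by [].
have xe : x ** e = x by rewrite /e xyC opA.
clearbody e.
suff [xx|xx] : x ** x = e \/ x ** x = x by rewrite xx ?ex.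
(* Here [e v e] is [e] or [x]. Then [x v x], resp. [e v x], equals [x x], which therefore lies in
   [{e, x}]. *)
have [v vP] := @regular_set (fun z => z = e \/ z = x) e x reg
  (or_introl erefl) (or_intror erefl).
have [[eve|eve] _] := vP e (or_introl erefl).
  have [_] := vP x (or_intror erefl).
  have -> : x ** v ** x = x ** (e ** v ** e) ** x by rewrite !opA xe -(opA _ e) ex.
  by rewrite eve xe.
have [] := vP x (or_intror erefl).
have -> : e ** v ** x = e ** v ** e ** x by rewrite -(opA _ e) ex.
by rewrite eve; auto.
Qed.

Lemma point_inj (x y : X) : principal (eq x) = principal (eq y) -> x = y.
Proof.
move=> xy; have : principal (eq y) (eq y) by [].
by rewrite -xy => /(_ x erefl) ->.
Qed.

Lemma point_op (x y : X) :
  principal (eq x) <*> principal (eq y) = principal (eq (x ** y)).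
Proof.
apply: family_eqP => E; rewrite (principal_opE _ _ (erefl x) (erefl y)).
by split=> xyE; [move=> _ <-; apply: xyE | move=> _ _ <- <-; apply: xyE].
Qed.

(** * Periodicity of powers in the sub-Clifford case *)

Section Powers.
Variable x : X.
(** The exponent is shifted: [u n] is the power of exponent [n + 1], so [u k = x] says that [k] is a
    period. *)
Local Notation u n := (iter n (op x) x).

Lemma powD m n : u m ** u n = u (m + n).+1.
Proof. by elim: m => //= m IHm; rewrite -opA IHm. Qed.

Lemma pow_shift k i : u k = x -> u (i + k) = u i.
Proof. by move=> uk; elim: i => //= i ->. Qed.

Lemma pow_mod k n : u k = x -> u (n %% k) = u n.
Proof.
move=> uk; rewrite {2}(divn_eq n k) addnC.
by elim: (n %/ k) => [|q IHq]; rewrite ?addn0 // mulSnr addnA pow_shift.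
Qed.

(** The point filters of all powers of [x] lie in one cancellative subsemigroup, where [x] can be
    cancelled [p] times. *)
Lemma pow_cancel p k :
  sg_sub_clifford (ext_op op) (@is_filter X) -> u p = u (p + k) -> u k = x.
Proof.
move=> subcliff.
have [C [[_ [CC Ccan]] Cx]] := subcliff _ (principal_filter (erefl x)).
have Cu n : C (principal (eq (u n))).
  by elim: n => //= n IHn; rewrite -point_op; apply: CC.
elim: p => [|p IHp] //= up; apply: IHp; apply: point_inj.
apply: (Ccan _ _ _ (Cu _) (Cu _) Cx).2.
by rewrite !point_op up.
Qed.

(* The tail filter [F] of the powers [x^n] with [d] not dividing [n] satisfies
   [F F = F F F], since every residue is a sum of two nonzero ones. *)
Lemma period_not_multiple d : 2 < d ->
  sg_sub_clifford (ext_op op) (@is_filter X) ->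
  exists k, ~~ (d %| k) /\ u k = x.
Proof.
move=> d3 subcliff.
pose v n := u n.
pose J n := ~~ (d %| n.+1) : Prop.
have nd1 : ~~ (d %| 1) by rewrite dvdn1; lia.
have nd2 : ~~ (d %| 2) by apply/negP => /(dvdn_leq (isT : 0 < 2)); lia.
have infJ N : exists n, N < n /\ J n.
  exists (d * N.+1); split; first nia.
  by rewrite /J -addn1 dvdn_addr // dvdn_mulr.
have infT N : exists n, N < n /\ True by exists N.+1.
pose F := tail v J; pose G := tail v (fun=> True).
have fF : is_filter F := tail_filter v infJ.
have FF : F <*> F = G.
  apply: family_eqP => E; rewrite (tail_opE op _ _ _ infJ infJ).
  split=> [[N NE] | [N NE]]; last first.
    exists N => m Nm _; exists N => n Nn _.
    by rewrite /v powD; apply: (NE (m + n).+1) => //; lia.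
  (* Left factors with exponents of residue 1 and 2 modulo [d] suffice: an exponent [t + 1] of
     residue 1 is split using residue 2, any other one using residue 1. *)
  have [||M1 M1E] := NE (d * N.+1).
  - nia.
  - by rewrite /J -addn1 dvdn_addr // dvdn_mulr.
  have [||M2 M2E] := NE (d * N.+1).+1.
  - nia.
  - by rewrite /J -addn2 dvdn_addr // dvdn_mulr.
  exists (d * N.+1 + M1 + M2).+3 => t tlarge _.
  have [dt|ndt] := boolP (d %| t).
    have -> : v t = v (d * N.+1).+1 ** v (t - (d * N.+1).+2).
      by rewrite /v powD; congr (iter _ _ _); lia.
    apply: M2E; first lia.
    rewrite /J; apply: contra nd1 => dn.
    have : d %| d * N.+1 + 1 + (t - (d * N.+1).+2).+1 by
      have -> : d * N.+1 + 1 + (t - (d * N.+1).+2).+1 = t by lia.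
    by rewrite dvdn_addl // dvdn_addr // dvdn_mulr.
  have -> : v t = v (d * N.+1) ** v (t - (d * N.+1).+1).
    by rewrite /v powD; congr (iter _ _ _); lia.
  apply: M1E; first lia.
  rewrite /J; apply: contra ndt => dn.
  have -> : t = d * N.+1 + (t - (d * N.+1).+1).+1 by lia.
  by rewrite dvdn_addr // dvdn_mulr.
have FG : F <*> G = G.
  apply: family_eqP => E; rewrite (tail_opE op _ _ _ infJ infT).
  split=> [[N NE] | [N NE]]; last first.
    exists N => m Nm _; exists N => n Nn _.
    by rewrite /v powD; apply: (NE (m + n).+1) => //; lia.
  have [m [Nm Jm]] := infJ N; have [M ME] := NE m Nm Jm.
  exists (M + m).+1 => t tlarge _.
  have -> : v t = v m ** v (t - m.+1).
    by rewrite /v powD; congr (iter _ _ _); lia.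
  by apply: ME => //; lia.
have [C [[_ [CC Ccan]] CF]] := subcliff _ fF.
(* Cancelling [F] in [F G = F F]. *)
have GF : G = F.
  rewrite -FF; apply: (Ccan _ _ _ (CC _ _ CF CF) CF CF).2.
  by rewrite FF FG.
have : F (fun z => exists2 n, J n & z = v n) by exists 0 => n _ Jn; exists n.
rewrite -GF => -[N NE].
(* This index has exponent [d (N + 2)], a multiple of [d], yet the power equals one whose exponent
   is not; the difference of the exponents is the desired period. *)
have [|//|m Jm vE] := NE (d * N.+2).-1; first nia.
have dn : d %| (d * N.+2).-1.+1 by rewrite prednK ?dvdn_mulr //; nia.
move: vE dn; set n := _.-1 => vE dn.
have [mn|nm] := leqP m n.
  exists (n - m); split; last by apply: (pow_cancel (p := m)) => //; rewrite subnKC.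
  apply: contra Jm => dnm.
  have : d %| m.+1 + (n - m) by have -> : m.+1 + (n - m) = n.+1 by lia.
  by rewrite dvdn_addl.
exists (m - n); split.
  apply: contra Jm => dnm.
  have -> : m.+1 = n.+1 + (m - n) by lia.
  by rewrite dvdn_addr.
by apply: (pow_cancel (p := n)) => //; rewrite subnKC // ltnW.
Qed.

(** Euclidean descent: a period [k > 2] and a period [l] not divisible by [k] leave the smaller
    positive period [l %% k]. Periods 1 and 2 both give the claim. *)
Lemma cube_of_sub_clifford :
  sg_sub_clifford (ext_op op) (@is_filter X) -> x ** x ** x = x.
Proof.
move=> subcliff; rewrite -opA.
have [k [ndk uk]] := period_not_multiple (isT : 2 < 3) subcliff.
have {ndk} k0 : 0 < k by case: k ndk {uk}.
elim/ltn_ind: k k0 uk => k IHk k0 uk.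
case: (ltnP 2 k) => [k3|]; last first.
  by case: k k0 uk {IHk} => [|[|[|]]] //= _ uk _; rewrite ?uk.
have [l [ndl ul]] := period_not_multiple k3 subcliff.
apply: (IHk (l %% k)); first by rewrite ltn_pmod.
  by rewrite lt0n.
by rewrite pow_mod.
Qed.

End Powers.

(** * The order of the idempotents and the subgroups *)

Lemma cube x : x ** x ** x = x.
Proof.
by case: filter_alt; [exact: cube_of_sub_clifford | exact: cube_of_regular].
Qed.

Lemma square_idem x : x ** x ** (x ** x) = x ** x.
Proof. by rewrite opA cube. Qed.

(** The assumptions make the filter [F] generated by [A] satisfy [F F F = F F]. Cancellation turns
    this into [F F = F], the first alternative; regularity gives the second. *)
Lemma set_dichotomy (A : X -> Prop) a : A a ->
  (forall x, A x -> exists y z, [/\ A y, A z & x = y ** z]) ->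
  (forall x y z, A x -> A y -> A z ->
     exists x' y', [/\ A x', A y' & x ** y ** z = x' ** y']) ->
  (forall x y, A x -> A y -> A (x ** y)) \/
  (forall x y, A x -> A y ->
     exists w, forall c, A c -> A (x ** w ** c) /\ A (y ** w ** c)).
Proof.
move=> Aa A2 A3; case: filter_alt => [subcliff | reg]; last first.
  by right=> x y; apply: regular_set.
left; pose F := principal A.
have fF : is_filter F := principal_filter Aa.
have FFF : F <*> F <*> F = F <*> F.
  apply: family_eqP => E.
  rewrite (principal_op3E _ _ Aa Aa Aa) (principal_opE _ _ Aa Aa).
  split=> [AE x y /A2[x1 [x2 [Ax1 Ax2 ->]]] Ay | AE x y z Ax Ay Az]; first exact: AE.
  by have [x' [y' [Ax' Ay' ->]]] := A3 _ _ _ Ax Ay Az; apply: AE.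
have [C [[_ [CC Ccan]] CF]] := subcliff _ fF.
have FF : F <*> F = F by apply: (Ccan _ _ _ (CC _ _ CF CF) CF CF).1.
have : F A by [].
by rewrite -FF (principal_opE _ _ Aa Aa).
Qed.

(** Dichotomy for [{e, f}]: in the second alternative [e w f] lies in [{e, f}] and is fixed by [e]
    on the left and by [f] on the right. *)
Lemma idem_chain e f : e ** e = e -> f ** f = f -> e ** f = e \/ e ** f = f.
Proof.
move=> ee ff; have efC := idem_comm ee ff.
pose A z := z = e \/ z = f.
have Ae : A e by left.
have Af : A f by right.
have efe : e ** f ** e = e ** f by rewrite -opA -efC opA ee.
have eff : e ** f ** f = e ** f by rewrite -opA ff.
have [|||w] := @set_dichotomy A e Ae.
- by move=> z [->|->]; [exists e, e | exists f, f].
- move=> x y z [->|->] [->|->] [->|->]; rewrite -?efC ?ee ?ff ?efe ?eff;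
    by [exists e, e | exists e, f | exists f, f].
- exact.
have {w}[w wP] := w e f Ae Af.
have [[ewe|ewe] _] := wP e Ae; last by right; rewrite -ewe !opA ee.
have [ewf _] := wP f Af.
have {ewf} : A (e ** w ** f) by [].
have [_ [fwf|fwf]] := wP f Af; first by left; rewrite -fwf -opA ff.
case=> ewf; [left | right]; last by rewrite -ewf !opA ee.
by rewrite -{1}ewf -(opA _ f) ff.
Qed.

(* If [x] is the nontrivial element of a two-element group with unit [e] lying
   strictly below [f], then [{f, x}] violates the dichotomy. *)
Lemma unit_of_lt_idem x e f :
  x ** x = e -> f ** f = f -> e ** f = e -> e <> f -> x = e.
Proof.
move=> xx ff ef nef.
have ee : e ** e = e by rewrite -xx square_idem.
have fe : f ** e = e by rewrite (idem_comm ff ee).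
have ex : e ** x = x by rewrite -xx cube.
have xe : x ** e = x by rewrite -xx opA cube.
have fx : f ** x = x by rewrite -{1}ex opA fe.
have xf : x ** f = x by rewrite -{1}xe -opA ef.
pose A z := z = f \/ z = x.
have Af : A f by left.
have Ax : A x by right.
have [||dich|w] := @set_dichotomy A f Af.
- by move=> z [->|->]; [exists f, f | exists f, x].
- move=> y z t [->|->] [->|->] [->|->]; rewrite ?ff ?fx ?xf ?xx ?ex ?ef ?ff ?fx ?xf ?xx;
    by [exists f, f | exists f, x | exists x, x].
- by case: (dich x x Ax Ax); rewrite xx => // exf; case: nef.
(* A product starting with [x] is fixed by [e] on the left, so it cannot be [f]. Hence
   [x w f = x w x = x], and [x x = x w f x = x w x = x]. *)
have {w}[w wP] := w f x Af Ax.
have [_ [xwf|xwf]] := wP f Af.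
  by case: nef; rewrite -ef -xwf !opA ex.
have [_ [xwx|xwx]] := wP x Ax.
  by case: nef; rewrite -ef -xwx !opA ex.
by rewrite -xx -{2}xwf -(opA _ f) fx.
Qed.

(** Only [e] itself has square [e], so it suffices that [z = e y] squares to [e]. Since [z z]
    commutes with [e = z y], one gets [z z = z z z y = z y = e]; [y e] is symmetric. *)
Lemma mul_lt_idem x y e f : x ** x = e -> y ** y = f ->
  e ** f = e -> e <> f -> [/\ x = e, e ** y = e & y ** e = e].
Proof.
move=> xx yy ef nef.
have ee : e ** e = e by rewrite -xx square_idem.
have ff : f ** f = f by rewrite -yy square_idem.
have fe : f ** e = e by rewrite (idem_comm ff ee).
have unit_e z : z ** z = e -> z = e.
  by move=> zz; apply: unit_of_lt_idem ef nef.
have comm_e z : e ** (z ** z) = z ** z ** e := idem_comm ee (square_idem z).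
split; first exact: unit_e.
  set z := e ** y.
  have ez : e ** z = z by rewrite /z opA ee.
  have zy : z ** y = e by rewrite /z -opA yy.
  clearbody z; apply: unit_e.
  by have := comm_e z; rewrite opA ez -{1}zy opA cube zy.
set z := y ** e.
have ze : z ** e = z by rewrite /z -opA ee.
have yz : y ** z = e by rewrite /z opA yy.
clearbody z; apply: unit_e.
by have := comm_e z; rewrite -(opA z z) ze -{1}yz -opA (opA z z) cube yz.
Qed.

(** Two distinct such elements would commute and generate a Klein four-group; its subset
    [{e, x, y}], which misses [x y], contradicts the dichotomy. *)
Lemma group_card_le2 x y e :
  x ** x = e -> y ** y = e -> x <> e -> y <> e -> x = y.
Proof.
move=> xx yy nx ny.
have ee : e ** e = e by rewrite -xx square_idem.
have ex : e ** x = x by rewrite -xx cube.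
have xe : x ** e = x by rewrite -xx opA cube.
have ey : e ** y = y by rewrite -yy cube.
have ye : y ** e = y by rewrite -yy opA cube.
have xyyx : x ** y ** (y ** x) = e by rewrite opA -(opA x) yy xe xx.
have sq : x ** y ** (x ** y) = e.
  have -> : x ** y ** (x ** y) = x ** y ** (x ** y) ** (x ** y ** (y ** x)).
    by rewrite xyyx -!opA ye.
  by rewrite opA cube.
have yxC : y ** x = x ** y.
  have -> : y ** x = e ** (y ** x) by rewrite opA ey.
  by rewrite -sq -opA xyyx -opA ye.
apply: contrapT => nxy.
have nxy_e : x ** y <> e.
  by move=> xy; apply: nxy; rewrite -xe -yy opA xy ey.
have nxy_x : x ** y <> x.
  by move=> xy; apply: ny; rewrite -ey -xx -opA xy.
have nxy_y : x ** y <> y.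
  by move=> xy; apply: nx; rewrite -xe -yy opA xy.
have nA : ~ (x ** y = e \/ x ** y = x \/ x ** y = y) by case=> [|[]].
pose A z := z = e \/ z = x \/ z = y.
have Ae : A e by left.
have Ax : A x by right; left.
have Ay : A y by right; right.
have xyx : x ** y ** x = y by rewrite -yxC -opA xx ye.
have xyy : x ** y ** y = x by rewrite -opA yy xe.
have xye : x ** y ** e = x ** y by rewrite -opA ye.
have [||dich|w] := @set_dichotomy A e Ae.
- by move=> z [->|[->|->]]; [exists e, e | exists e, x | exists e, y].
- move=> a b c [->|[->|->]] [->|[->|->]] [->|[->|->]];
    rewrite ?(ee, ex, xe, ey, ye, xx, yy, yxC, xyx, xyy, xye);
    by [exists e, e | exists e, x | exists e, y | exists x, y
       | exists x, e | exists y, e].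
- exact: nA (dich x y Ax Ay).
have {w}[w wP] := w e x Ae Ax.
(* Replacing [w] by [e w e] puts it into [{e, x, y}]; each of the three values then forces [x y]
   into that set. *)
have ewe c : A c -> A (e ** w ** e ** c).
  move=> Ac; have -> : e ** w ** e ** c = e ** w ** c.
    by rewrite -(opA _ e); case: Ac => [->|[->|->]]; rewrite ?ee ?ex ?ey.
  by have [] := wP c Ac.
have xwe c : A c -> A (x ** (e ** w ** e) ** c).
  move=> Ac; have -> : x ** (e ** w ** e) ** c = x ** w ** c.
    rewrite !opA xe -(opA _ e).
    by case: Ac => [->|[->|->]]; rewrite ?ee ?ex ?ey.
  by have [] := wP c Ac.
have := ewe e Ae; rewrite -(opA _ e) ee => -[|[]] wE.
- by have := xwe y Ay; rewrite wE xe => /nA.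
- by have := ewe y Ay; rewrite wE => /nA.
- by have := ewe x Ax; rewrite wE yxC => /nA.
Qed.

End Structure.

Lemma sg_iso_of_bijection (X Y : Type) (opX : X -> X -> X) (opY : Y -> Y -> Y)
    (g : Y -> X) :
  injective g -> (forall x, exists y, g y = x) ->
  (forall y z, g (opY y z) = opX (g y) (g z)) -> sg_iso opX opY.
Proof.
move=> g_inj /choice[f fK] gM; exists f; split.
  by exists g => // y; apply: g_inj.
by move=> x y; apply: g_inj; rewrite gM !fK.
Qed.

(** Dependent choice, with transitivity extending consecutive steps to all pairs. *)
Lemma relation_sequence (X : Type) (A : X -> Prop) (R : X -> X -> Prop) a :
  A a -> (forall x, A x -> exists y, A y /\ R x y) ->
  (forall x y z, R x y -> R y z -> R x z) ->
  exists u : nat -> X, (forall n, A (u n)) /\ forall m n, m < n -> R (u m) (u n).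
Proof.
move=> Aa AR Rtrans.
have /choice[f fP] : forall x, exists y, A x -> A y /\ R x y.
  by move=> x; have [/AR[y yP]|nAx] := EM (A x); [exists y | exists x].
pose u n := iter n f a.
have uA n : A (u n) by elim: n => //= n /fP[].
exists u; split=> // m n; elim: n => // n IHn.
rewrite ltnS leq_eqVlt => /predU1P[->|/IHn Rmn].
  by have [] := fP _ (uA n).
by apply: Rtrans Rmn _; have [] := fP _ (uA n).
Qed.

(** * Finiteness of the chain of idempotents and classification of [X] *)

Section Chain.
Variables (X : Type) (op : X -> X -> X).
Hypothesis opA : associative op.
Hypothesis filter_idemC : idempotents_commute (ext_op op) (@is_filter X).
Hypothesis filter_alt : sg_sub_clifford (ext_op op) (@is_filter X) \/
  regular_in (ext_op op) (@is_filter X) (@is_linked X).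

Local Notation "x ** y" := (op x y) (at level 40, left associativity).
Local Notation "F <*> G" := (ext_op op F G) (at level 40, left associativity).

(* The tail filters on the odd and on the even indices form a left zero or a
   right zero band. *)
Lemma no_monotone_sequence (u : nat -> X) :
  (forall m n, m < n -> u m <> u n) ->
  (forall m n, m < n -> u m ** u n = u n) \/
  (forall m n, m < n -> u m ** u n = u m) -> False.
Proof.
move=> u_neq u_mono.
pose J b n : Prop := odd n = b.
have infJ b N : exists n, N < n /\ J b n.
  have [oN|oN] := eqVneq (odd N) b.
    by exists N.+2; split; [lia | rewrite /J /= negbK].
  by exists N.+1; split; [lia | rewrite /J /=; case: (odd N) b oN => -[]].
pose F b := tail u (J b).
have fF b : is_filter (F b) := tail_filter u (infJ b).
have FE : (forall b c, F b <*> F c = F c) \/ (forall b c, F b <*> F c = F b).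
- case: u_mono => u_mono; [left | right] => b c; apply: family_eqP => E;
    rewrite (tail_opE op _ _ _ (infJ b) (infJ c)); split=> [[N NE] | [N NE]].
  + have [m [Nm Jm]] := infJ b N; have [M ME] := NE m Nm Jm.
    exists (maxn M m) => n; rewrite gtn_max => /andP[Mn mn] Jn.
    by rewrite -(u_mono _ _ mn); apply: ME.
  + exists N => m Nm Jm; exists m => n mn Jn.
    by rewrite u_mono //; apply: NE => //; lia.
  + exists N => m Nm Jm; have [M ME] := NE m Nm Jm.
    have [n [Mn Jn]] := infJ c (maxn M m).
    move: Mn; rewrite gtn_max => /andP[Mn mn].
    by rewrite -(u_mono _ _ mn); apply: ME.
  + exists N => m Nm Jm; exists m => n mn Jn.
    by rewrite u_mono //; apply: NE.
have eqF : F true = F false.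
  have comm := filter_idemC (fF true) (fF false).
  by case: FE => FE; move: comm; rewrite !FE => ->.
(* The odd-indexed terms form a member of both filters, so some even-indexed term equals an
   odd-indexed one. *)
have : F true (fun z => exists2 n, J true n & z = u n).
  by exists 0 => n _ Jn; exists n.
rewrite eqF => -[N NE]; have [m [Nm Jm]] := infJ false N.
have [n Jn umn] := NE m Nm Jm.
have [mn|nm|mn] := ltngtP m n.
- exact: (u_neq _ _ mn).
- exact: (u_neq _ _ nm).
- by move: Jm; rewrite mn /J Jn.
Qed.

Lemma idem_lt_trans e f g :
  [/\ e ** f = e, f ** e = e & e <> f] -> [/\ f ** g = f, g ** f = f & f <> g] ->
  [/\ e ** g = e, g ** e = e & e <> g].
Proof.
move=> [ef fe nef] [fg gf _]; split.
- by rewrite -{1}ef -opA fg.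
- by rewrite -{1}fe opA gf.
- by move=> eg; move: gf; rewrite -eg ef.
Qed.

Let idemC e f : e ** e = e -> f ** f = f -> e ** f = f ** e.
Proof. exact: idem_comm. Qed.

Let chain e f : e ** e = e -> f ** f = f -> e ** f = e \/ e ** f = f.
Proof. exact: idem_chain. Qed.

(** Without a minimum, comparability yields a strictly smaller element below each one, hence a
    strictly descending sequence. *)
Lemma idem_has_min (A : X -> Prop) a : A a -> (forall e, A e -> e ** e = e) ->
  exists m, A m /\ forall e, A e -> m ** e = m.
Proof.
move=> Aa idA; apply: contrapT => no_min.
have step x : A x -> exists y,
    A y /\ [/\ y ** x = y, x ** y = y & y <> x].
  move=> Ax; apply: contrapT => nx; apply: no_min; exists x; split=> // e Ae.
  have [//|xe] := chain (idA _ Ax) (idA _ Ae).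
  have [ex_eq|nex] := EM (e = x); first by rewrite xe ex_eq.
  by case: nx; exists e; split=> //; split=> //; rewrite -idemC; auto.
have [u [_ uP]] := relation_sequence Aa step
  (fun x y z yx zy => idem_lt_trans zy yx).
apply: (@no_monotone_sequence u).
  by move=> m n /uP[_ _ neq] eq; apply: neq.
by left=> m n /uP[].
Qed.

Lemma idem_has_max (A : X -> Prop) a : A a -> (forall e, A e -> e ** e = e) ->
  exists m, A m /\ forall e, A e -> e ** m = e.
Proof.
move=> Aa idA; apply: contrapT => no_max.
have step x : A x -> exists y,
    A y /\ [/\ x ** y = x, y ** x = x & x <> y].
  move=> Ax; apply: contrapT => nx; apply: no_max; exists x; split=> // e Ae.
  have [//|ex] := chain (idA _ Ae) (idA _ Ax).
  have [xe_eq|nxe] := EM (x = e); first by rewrite ex xe_eq.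
  by case: nx; exists e; split=> //; split=> //; rewrite idemC; auto.
have [u [_ uP]] := relation_sequence Aa step idem_lt_trans.
apply: (@no_monotone_sequence u).
  by move=> m n /uP[].
by right=> m n /uP[].
Qed.

(** The idempotents below [e] form the chain [g 0 < ... < g n = e]; only the values of [g] up to [n]
    are constrained. *)
Definition enumerates_below (e : X) (n : nat) (g : nat -> X) :=
  [/\ g n = e,
      forall i j, i <= j -> j <= n -> g i ** g j = g i,
      forall i j, i < j -> j <= n -> g i <> g j
    & forall f, f ** f = f -> f ** e = f -> exists2 i, i <= n & f = g i].

(** Take a minimal counterexample [m]. If [m] is not the least idempotent, it has a largest strict
    predecessor [b], which is enumerated by minimality, and appending [m] enumerates below [m]. *)
Lemma idem_finite_below e : e ** e = e -> exists n g, enumerates_below e n g.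
Proof.
move=> ee; apply: contrapT => infe.
pose A e := e ** e = e /\ ~ exists n g, enumerates_below e n g.
have [||m [[mm infm] m_min]] := @idem_has_min A e; [by split | by move=> ? []|].
apply: infm.
pose B f := [/\ f ** f = f, f ** m = f & f <> m].
have [[b0 Bb0]|noB] := EM (exists b, B b); last first.
  exists 0, (fun=> m); split=> //; first by move=> i j; lia.
  move=> f ff fm; exists 0 => //; apply: contrapT => nfm.
  by apply: noB; exists f.
have [|b [[bb bm nbm] b_max]] := idem_has_max Bb0; first by move=> ? [].
have [n [g [gn gM g_neq g_onto]]] : exists n g, enumerates_below b n g.
  apply: contrapT => infb; apply: nbm.
  by rewrite -bm idemC // m_min.
pose h i := if i <= n then g i else m.
have gi_m i : i <= n -> g i ** m = g i.
  by move=> ilen; rewrite -(gM i n) // -opA gn bm.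
exists n.+1, h; split.
- by rewrite /h ltnn.
- move=> i j ij jn; rewrite /h; case: (leqP j n) => jn'.
    by rewrite (leq_trans ij jn') gM.
  by case: leqP => // ilen; apply: gi_m.
- move=> i j ij jn; rewrite /h; case: (leqP j n) => jn'.
    by rewrite (leq_trans (ltnW ij) jn'); apply: g_neq.
  have ilen : i <= n by lia.
  rewrite ilen => gim; apply: nbm.
  by rewrite -bm -gim -[b in LHS]gn idemC ?gM // gn ?bb // gim.
- move=> f ff fm; have [fm'|nfm] := EM (f = m).
    by exists n.+1 => //; rewrite /h ltnn.
  have [|i ilen ->] := g_onto f ff; first by apply: b_max.
  by exists i; [lia | rewrite /h ilen].
Qed.

(** An element whose square is not the top idempotent [m] is idempotent, and at most one [t <> m]
    has square [m]. Its presence decides between the two shapes; a bare [C_2] appears as the case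
    [n = 0] of the second. *)
Lemma chain_or_chain_C2 :
  (exists n, sg_iso op (@Ln_op n)) \/
  (exists n, sg_iso op (ord_union_op (@Ln_op n) (@Cn_op 2))).
Proof.
have [[x0 _]|empty] := EM (exists x : X, True); last first.
  left; exists 0.
  apply: (@sg_iso_of_bijection _ _ _ _
    (fun i : 'I_0 => False_rect X (notF (ltn_ord i)))).
  - by case.
  - by move=> x; case: empty; exists x.
  - by case.
pose I e := e ** e = e.
have sqI x : I (x ** x) by apply: square_idem.
have [//|m [mm m_max]] := @idem_has_max I _ (sqI x0).
have [n [g [gn gM g_neq g_onto]]] := idem_finite_below mm.
have g_inj i j : i <= n -> j <= n -> g i = g j -> i = j.
  move=> ilen jlen gij; have [ij|ji|//] := ltngtP i j.
    by case: (g_neq i j).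
  by case: (g_neq j i).
have lt_square x : x ** x <> m -> x = x ** x.
  move=> nxm.
  by have [] := @mul_lt_idem _ _ opA filter_idemC filter_alt x m _ m
    erefl mm (m_max _ (sqI x)) nxm.
have not_top x : x ** x <> m -> exists2 i, i <= n & x = g i.
  move=> /lt_square ->; exact: g_onto (sqI x) (m_max _ (sqI x)).
have [[t [tt ntm]]|no_t] := EM (exists t, t ** t = m /\ t <> m); last first.
  left; exists n.+1; apply: (@sg_iso_of_bijection _ _ _ _ (fun i : 'I_n.+1 => g i)).
  - by move=> i j /g_inj eq; apply/val_inj/eq; rewrite -ltnS.
  - move=> x; have [i ilen ->] : exists2 i, i <= n & x = g i.
      have [xm|/not_top//] := EM (x ** x = m).
      exists n => //; rewrite gn; apply: contrapT => nxm.
      by apply: no_t; exists x.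
    by exists (Ordinal (ilen : i < n.+1)).
  - move=> i j; have [ilen jlen] := (ltn_ord i, ltn_ord j).
    rewrite /Ln_op; case: leqP => ij; first by rewrite gM.
    have gI k : k <= n -> g k ** g k = g k by move=> ?; apply: gM.
    by rewrite idemC ?gI // gM // ltnW.
(* The idempotent [g n = m] leaves the chain and becomes the unit of [C_2], so exactly [n]
   idempotents remain in [L_n]. *)
right; exists n.
pose top b := if b then t else m.
pose h (y : 'I_n + Cn 2) := match y with
  | inl i => g i
  | inr z => top (sval z != 1%R)
  end.
have topE b : h (inr (C2_of_bool b)) = top b.
  rewrite /h; congr top; case: b => /=; last by rewrite eqxx.
  apply/eqP => eq1.
  by have /C2_of_bool_inj : C2_of_bool true = C2_of_bool false by apply: val_inj.
have tm : t ** m = t by rewrite -tt opA cube.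
have mt : m ** t = t by rewrite -tt cube.
have topM a b : top a ** top b = top (a (+) b).
  by case: a; case: b; rewrite /top /= ?tt ?tm ?mt ?mm.
have gI k : k <= n -> g k ** g k = g k by move=> ?; apply: gM.
have gtop i b : i < n -> g i <> top b /\ g i ** top b = g i /\ top b ** g i = g i.
  move=> iltn; have gim : g i <> m by rewrite -gn; apply: g_neq.
  have gi_m : g i ** m = g i by rewrite -gn gM // ltnW.
  have top2 : top b ** top b = m by rewrite topM addbb.
  split; last first.
    by have [_ ->] := @mul_lt_idem _ _ opA filter_idemC filter_alt (g i) (top b) _ _
      (gI _ (ltnW iltn)) top2 gi_m gim.
  by move=> gtop; apply: gim; rewrite -top2 -gtop gI // ltnW.
apply: (@sg_iso_of_bijection _ _ _ _ h).
- move=> [i|y] [j|z].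
  + by move=> /g_inj eq; congr inl; apply/val_inj/eq; apply: ltnW.
  + have [b <-] := C2_of_bool_surj z; rewrite topE => eq.
    by have [/(_ eq)] := gtop i b (ltn_ord i).
  + have [b <-] := C2_of_bool_surj y; rewrite topE => eq.
    by have [/(_ (esym eq))] := gtop j b (ltn_ord j).
  + have [a <-] := C2_of_bool_surj y; have [b <-] := C2_of_bool_surj z.
    by rewrite !topE; case: a; case: b => //= eq; case: ntm.
- move=> x; have [xm|nxm] := EM (x ** x = m).
    have [->|nx] := EM (x = m); first by exists (inr (C2_of_bool false)); rewrite topE.
    exists (inr (C2_of_bool true)); rewrite topE.
    by rewrite /top; apply: group_card_le2 tt xm ntm nx.
  have [i ilen xg] := not_top x nxm.
  have iltn : i < n.
    rewrite ltn_neqAle ilen andbT; apply/eqP => i_n; apply: nxm.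
    by rewrite xg i_n gn.
  by exists (inl (Ordinal iltn)).
- move=> [i|y] [j|z].
  + rewrite /= /Ln_op; have [ilen jlen] := (ltnW (ltn_ord i), ltnW (ltn_ord j)).
    case: leqP => ij; first by rewrite gM.
    by rewrite idemC ?gI // gM // ltnW.
  + have [b <-] := C2_of_bool_surj z; rewrite topE /=.
    by have [_ [-> _]] := gtop i b (ltn_ord i).
  + have [b <-] := C2_of_bool_surj y; rewrite topE /=.
    by have [_ [_ ->]] := gtop j b (ltn_ord j).
  + have [a <-] := C2_of_bool_surj y; have [b <-] := C2_of_bool_surj z.
    rewrite -[ord_union_op _ _ _ _]/(inr (Cn_op (C2_of_bool a) (C2_of_bool b))).
    by rewrite C2_of_boolM !topE topM.
Qed.

End Chain.

(** * The cycle of implications *)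

Theorem theorem1p2 (X : Type) (op : X -> X -> X) (Hassoc : associative op) :
  [<-> sg_commutative (ext_op op) (@is_filter X) /\ sg_clifford (ext_op op) (@is_filter X);
       sg_inverse (ext_op op) (@is_filter X);
       idempotents_commute (ext_op op) (@is_filter X) /\
         (sg_sub_clifford (ext_op op) (@is_filter X) \/
          regular_in (ext_op op) (@is_filter X) (@is_linked X));
       sg_iso op (@Cn_op 2) \/
         (exists n : nat, sg_iso op (@Ln_op n)) \/
         (exists n : nat, sg_iso op (ord_union_op (@Ln_op n) (@Cn_op 2)))].
Proof.
have opS := @ext_op_filter X op.
have opA := @filter_opA X op Hassoc.
tfae.
- by move=> [comm cliff]; apply: inverse_of_commutative_clifford opA comm cliff.
- move=> inv; split; first exact: (idempotents_commute_of_inverse opS opA inv).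
  right=> F fF; have [G [[fG [FGF _]] _]] := inv F fF.
  by exists G; split; first exact: filter_linked.
- by move=> [idemC alt]; right; apply: chain_or_chain_C2.
- case=> [|[[n]|[n]]]; first exact: C2_commutative_clifford.
    exact: Ln_commutative_clifford.
  exact: ord_union_C2_commutative_clifford.
Qed.
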